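(* Let $\mathbb P$ be a probability measure on $\Omega_+$ under which the sequence $(\omega(x))_{x\ge0}$ is stationary and ergodic (with respect to the shift). Then either every $x\ge0$ is $\mathbb P$-a.s. $\omega$-recurrent, or every $x\ge0$ is $\mathbb P$-a.s. $\omega$-transient.
   Context: Cookie environments: $\Omega_+=([1/2,1]^{\mathbb N})^{\mathbb Z}$ with its product $\sigma$-field, $\omega(x)=(\omega(x,i))_{i\ge1}$. $P_{x,\omega}$ is the law of the nearest-neighbor process $(X_n)_{n\ge0}$ with $X_0=x$ which, on its $i$-th visit to site $z$, jumps to $z+1$ with probability $\omega(z,i)$ and to $z-1$ otherwise. $R_k=\{X_n=k\text{ i.o.}\}$; a site $y$ is $\omega$-recurrent if $P_{x,\omega}[R_y]=1$ for all $x\in\mathbb Z$, and $\omega$-transient if $P_{x,\omega}[R_y]=0$ for all $x\in\mathbb Z$ (for fixed $\omega$ one of these always holds). *)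

(* Defs.v *)
From HB Require Import structures.
From mathcomp Require Import all_boot all_order all_algebra.
From mathcomp Require Import all_classical all_reals all_analysis.
Set Implicit Arguments. Unset Strict Implicit. Unset Printing Implicit Defensive.
Import Order.TTheory GRing.Theory Num.Theory.
Local Open Scope classical_set_scope.
Local Open Scope ring_scope.

(* Environments.  An environment is w : int -> nat -> R, where w z k stands   *)
(* for the paper's omega(z, k+1) (the cookie used on the (k+1)-th visit to z).*)
(* The cookie space Omega_+ = ([1/2,1]^N)^Z is the subset of these functions *)
(* with all values in [1/2,1]; a probability on Omega_+ is represented as a   *)
(* probability on the ambient product space concentrated on Omega_+.        *)

Definition env (R : realType) := int -> nat -> R.
HB.instance Definition _ (R : realType) := Choice.on (env R).
HB.instance Definition _ (R : realType) := isPointed.Build (env R) (fun _ _ => 0).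

Definition env_coords (R : realType) : set (set (env R)) :=
  fun A => exists (z : int) (k : nat) (B : set R),
    measurable B /\ A = (fun w : env R => w z k) @^-1` B.

Notation Omega R := (g_sigma_algebraType (@env_coords R)).

Definition in_Omega_plus (R : realType) (w : env R) : Prop :=
  forall z k, 2^-1 <= w z k <= 1.

Definition seqenv (R : realType) := nat -> nat -> R.
HB.instance Definition _ (R : realType) := Choice.on (seqenv R).
HB.instance Definition _ (R : realType) := isPointed.Build (seqenv R) (fun _ _ => 0).

Definition seq_coords (R : realType) : set (set (seqenv R)) :=
  fun A => exists (x k : nat) (B : set R),
    measurable B /\ A = (fun u : seqenv R => u x k) @^-1` B.

Notation SeqOmega R := (g_sigma_algebraType (@seq_coords R)).

Definition proj_nonneg (R : realType) (w : Omega R) : SeqOmega R :=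
  fun (x : nat) k => w (x%:Z) k.

Definition seq_shift (R : realType) (u : SeqOmega R) : SeqOmega R :=
  fun x => u x.+1.

Arguments proj_nonneg {R}.
Arguments seq_shift {R}.

Definition stationary (R : realType) (P : probability (Omega R) R) : Prop :=
  forall A : set (SeqOmega R), measurable A ->
    P (proj_nonneg @^-1` A) = P (proj_nonneg @^-1` (seq_shift @^-1` A)).

Definition ergodic (R : realType) (P : probability (Omega R) R) : Prop :=
  forall A : set (SeqOmega R), measurable A ->
    seq_shift @^-1` A = A ->
    P (proj_nonneg @^-1` A) = 0%E \/ P (proj_nonneg @^-1` A) = 1%E.

Definition step (z : int) (b : bool) : int := if b then z + 1 else z - 1.

Fixpoint positions (x : int) (s : seq bool) : seq int :=
  x :: (if s is b :: s' then positions (step x b) s' else [::]).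

(* probability under P_{.,w} of performing the steps s, when the walk is at   *)
(* [pos] and [hist] is the list of its previous positions.  At the           *)
(* (k+1)-th visit to pos (k = number of previous visits) it jumps right      *)
(* with probability omega(pos, k+1) = w pos k.                               *)
Fixpoint path_prob (R : realType) (w : env R) (hist : seq int) (pos : int)
    (s : seq bool) : R :=
  if s is b :: s' then
    let p := w pos (count (pred1 pos) hist) in
    (if b then p else 1 - p) * path_prob w (pos :: hist) (step pos b) s'
  else 1.

Definition visits_prob (R : realType) (w : env R) (x y : int) (m n : nat) : R :=
  \sum_(s : n.-tuple bool | (m <= count (pred1 y) (positions x s))%N)
     path_prob w [::] x s.

(* P_{x,w}[R_y] = P_{x,w}[X_n = y i.o.]
   = lim_m lim_n P_{x,w}[at least m visits to y up to time n]
   (monotone limits: nondecreasing in n, nonincreasing in m). *)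
Definition hit_io (R : realType) (w : env R) (x y : int) : R :=
  inf (range (fun m : nat => sup (range (fun n : nat => visits_prob w x y m n)))).

Definition recurrent_site (R : realType) (w : env R) (y : int) : Prop :=
  forall x : int, hit_io w x y = 1.

Definition transient_site (R : realType) (w : env R) (y : int) : Prop :=
  forall x : int, hit_io w x y = 0.

(* Main.v *)
Require Import Defs.
From HB Require Import structures.
From mathcomp Require Import all_boot all_order all_algebra.
From mathcomp Require Import all_classical all_reals all_analysis.
From mathcomp Require Import measurable_realfun zify ring lra.
Import Order.TTheory GRing.Theory Num.Theory.
Import numFieldNormedType.Exports.
Local Open Scope classical_set_scope.
Local Open Scope ring_scope.

(* Since the drift points to the right, excursions to the left of a site y are
   a.s. finite, so y is visited infinitely often iff all excursions to the right
   of y are finite. If m such excursions are made, the numbers of jumps from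
   y + k to y + k + 1 form a Markov chain in k, because the cookies of distinct
   sites are used independently: from j jumps the chain moves to the number of
   successes before the j-th failure in the cookie stack of the next site. The m
   excursions are finite iff this chain dies out. Let d(y) be the limit of its
   extinction probability as m tends to infinity. Looking one level further gives
   d(y) <= d(y + 1), so stationarity forces d to be a.s. constant. If the constant
   p is positive, every chain is, at every level, extinct or dies out later with
   probability at least p, hence it dies out a.s. and all sites are recurrent; if
   p = 0 all sites are transient. Ergodicity decides between the two cases.
   The link with the walk is that the law of the chain, with the stacks shifted
   by the cookies already used, is harmonic for the walk. *)

(** * Success counts in independent trials *)

(* Expectation of [a] at the number of successes before the [k]-th failure, on
   the event that at most [f] trials are needed, where the [i]-th trial succeeds
   with probability [p i]. *)
Fixpoint nexp {R : realType} (p a : nat -> R) (f k : nat) {struct f} : R :=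
  match k, f with
  | 0%N, _ => a 0%N
  | k'.+1, 0%N => 0
  | k'.+1, f'.+1 =>
      p 0%N * nexp (fun i => p i.+1) (fun j => a j.+1) f' k
      + (1 - p 0%N) * nexp (fun i => p i.+1) a f' k'
  end.

(* Expectation of [a] at the number of successes among the first [k] trials. *)
Fixpoint bexp {R : realType} (p a : nat -> R) (k : nat) : R :=
  if k is k'.+1 then
    p 0%N * bexp (fun i => p i.+1) (fun j => a j.+1) k'
    + (1 - p 0%N) * bexp (fun i => p i.+1) a k'
  else a 0%N.

Definition prob_seq {R : realType} (p : nat -> R) := forall i, 0 <= p i <= 1.
Definition right_seq {R : realType} (p : nat -> R) := forall i, 2^-1 <= p i <= 1.

Lemma right_prob_seq {R : realType} (p : nat -> R) : right_seq p -> prob_seq p.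
Proof. by move=> hp i; have := hp i; lra. Qed.

Lemma ler_conv {R : realDomainType} (p a b c d : R) :
  0 <= p <= 1 -> a <= c -> b <= d -> p * a + (1 - p) * b <= p * c + (1 - p) * d.
Proof.
move=> /andP[p0 p1] ac bd; apply: lerD; apply: ler_wpM2l => //.
by rewrite subr_ge0.
Qed.

Lemma nexpk0 {R : realType} (p a : nat -> R) f : nexp p a f 0 = a 0%N.
Proof. by case: f. Qed.

Lemma nexp_le {R : realType} (p a b : nat -> R) f k : prob_seq p ->
  (forall j, (j <= f)%N -> a j <= b j) -> nexp p a f k <= nexp p b f k.
Proof.
elim: f p a b k => [|f IH] p a b [|k] hp hab //=; try exact: hab.
apply: ler_conv => //.
  by apply: IH => [i|j jf]; [exact: hp|exact: hab].
by apply: IH => [i|j jf]; [exact: hp|apply: hab; rewrite ltnW].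
Qed.

Lemma nexp_lin {R : realType} (p a b : nat -> R) (x y : R) f k :
  nexp p (fun j => x * a j + y * b j) f k = x * nexp p a f k + y * nexp p b f k.
Proof.
elim: f p a b k => [|f IH] p a b [|k] //=; first by rewrite !mulr0 addr0.
by rewrite (IH _ (fun j => a j.+1) (fun j => b j.+1)) IH; ring.
Qed.

Lemma bexp_lin {R : realType} (p a b : nat -> R) (x y : R) k :
  bexp p (fun j => x * a j + y * b j) k = x * bexp p a k + y * bexp p b k.
Proof.
elim: k p a b => [|k IH] p a b //=.
by rewrite (IH _ (fun j => a j.+1) (fun j => b j.+1)) IH; ring.
Qed.

Lemma bexp_le {R : realType} (p a b : nat -> R) k : prob_seq p ->
  (forall j, a j <= b j) -> bexp p a k <= bexp p b k.
Proof.
elim: k p a b => [|k IH] p a b hp hab //=.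
by apply: ler_conv => //; apply: IH => // i; exact: hp.
Qed.

Lemma bexp_cst {R : realType} (p : nat -> R) c k : bexp p (fun=> c) k = c.
Proof. by elim: k p => [|k IH] p //=; rewrite !IH; ring. Qed.

Lemma nexp0 {R : realType} (p : nat -> R) f k : nexp p (fun=> 0) f k = 0.
Proof. by elim: f p k => [|f IH] p [|k] //=; rewrite !IH; ring. Qed.

Lemma nexp_ge0 {R : realType} (p a : nat -> R) f k : prob_seq p ->
  (forall j, 0 <= a j) -> 0 <= nexp p a f k.
Proof. by move=> hp ha; rewrite -(nexp0 p f k); apply: nexp_le. Qed.

Lemma nexp_le_cst {R : realType} (p a : nat -> R) c f k : prob_seq p -> 0 <= c ->
  (forall j, a j <= c) -> nexp p a f k <= c.
Proof.
elim: f p a k => [|f IH] p a [|k] hp c0 hac //=.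
rewrite [leRHS](_ : c = p 0%N * c + (1 - p 0%N) * c); last by ring.
by apply: ler_conv => //; apply: IH => // i; exact: hp.
Qed.

Lemma nexp_fuel {R : realType} (p a : nat -> R) f f' k : prob_seq p ->
  (forall j, 0 <= a j) -> (f <= f')%N -> nexp p a f k <= nexp p a f' k.
Proof.
elim: f p a f' k => [|f IH] p a f' [|k] hp ha.
- by rewrite !nexpk0.
- by move=> _; apply: nexp_ge0.
- by rewrite !nexpk0.
- case: f' => // f' ff' /=.
  by apply: ler_conv => //; apply: IH => // i; exact: hp.
Qed.

(** Waiting for one more failure can only add successes, where [a] is smaller, or exhaust the
    trials, which counts as 0. *)
Lemma nexp_anti1 {R : realType} (p a : nat -> R) f k : prob_seq p ->
  (forall j, 0 <= a j) -> {homo a : i j / (i <= j)%N >-> j <= i} ->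
  nexp p a f k.+1 <= nexp p a f k.
Proof.
elim: f p a k => [|f IH] p a [|k] hp ha hh.
- exact: ha.
- exact: lexx.
- rewrite nexpk0; apply: nexp_le_cst => // j; exact: hh.
- by apply: ler_conv => //; apply: IH => // i j ij; exact: hh.
Qed.

Lemma nexp_anti {R : realType} (p a : nat -> R) f k k' : prob_seq p ->
  (forall j, 0 <= a j) -> {homo a : i j / (i <= j)%N >-> j <= i} ->
  (k <= k')%N -> nexp p a f k' <= nexp p a f k.
Proof.
move=> hp ha hh /subnKC <-; elim: (k' - k)%N => [|n IH]; first by rewrite addn0.
by rewrite addnS; apply: le_trans IH; apply: nexp_anti1.
Qed.

(* [(2/3)^k] is a supersolution for the weight [2^-j]: when [p >= 1/2],
   [p/2 + (1-p) * 3/2 <= 1]. *)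
Lemma nexp_pow {R : realType} (p : nat -> R) (B : R) f k : right_seq p -> 0 <= B ->
  nexp p (fun j => B * 2^-1 ^+ j) f k <= B * (2 / 3) ^+ k.
Proof.
elim: f p B k => [|f IH] p B [|k] hp B0.
- by rewrite nexpk0 !expr0.
- by rewrite mulr_ge0// exprn_ge0//; lra.
- by rewrite nexpk0 !expr0.
rewrite /=; set q := (fun i => p i.+1).
have hq : right_seq q by move=> i; exact: hp.
rewrite (_ : (fun j => B * 2^-1 ^+ j.+1) = (fun j => (B / 2) * 2^-1 ^+ j)); last first.
  by apply/funext => j; rewrite exprS mulrA.
have := ler_conv _ _ _ _ _ (right_prob_seq _ hp 0%N) (IH q (B / 2) k.+1 hq ltac:(lra))
  (IH q B k hq B0).
move/le_trans; apply.
have : 0 <= B * (2 / 3) ^+ k by rewrite mulr_ge0// exprn_ge0//; lra.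
have := hp 0%N; rewrite exprS; set x := _ ^+ k.
set P := p 0%N; move=> hP hx.
have -> : P * (B / 2 * (2 / 3 * x)) + (1 - P) * (B * x)
  = (1 - P * (2/3)) * (B * x) by field.
have -> : B * (2 / 3 * x) = (2 / 3) * (B * x) by ring.
by apply: ler_wpM2r => //; lra.
Qed.

(** Each trial multiplies the mean of the weight [2^-j] by [1 - p/2], which is at most 3/4 when
    [p >= 1/2]. *)
Lemma bexp_pow {R : realType} (p : nat -> R) (B : R) k : right_seq p -> 0 <= B ->
  bexp p (fun j => B * 2^-1 ^+ j) k <= B * (3 / 4) ^+ k.
Proof.
elim: k p B => [|k IH] p B hp B0; first by rewrite /= !expr0.
rewrite /=; set q := (fun i => p i.+1).
have hq : right_seq q by move=> i; exact: hp.
rewrite (_ : (fun j => B * 2^-1 ^+ j.+1) = (fun j => (B / 2) * 2^-1 ^+ j)); last first.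
  by apply/funext => j; rewrite exprS mulrA.
have := ler_conv _ _ _ _ _ (right_prob_seq _ hp 0%N) (IH q (B / 2) hq ltac:(lra))
  (IH q B hq B0).
move/le_trans; apply.
have : 0 <= B * (3 / 4) ^+ k by rewrite mulr_ge0// exprn_ge0//; lra.
have := hp 0%N; rewrite exprS; set x := _ ^+ k.
set P := p 0%N; move=> hP hx.
have -> : P * (B / 2 * x) + (1 - P) * (B * x)
  = (1 - P / 2) * (B * x) by field.
have -> : B * (3 / 4 * x) = (3 / 4) * (B * x) by ring.
by apply: ler_wpM2r => //; lra.
Qed.

(** For [j >= M] monotonicity suffices; for [j < M] the factor [2^(M - j)] is at least 1. The
    trivial factors match the shape of [nexp_lin] and [bexp_lin]. *)
Lemma anti_le_pow {R : realType} (a : nat -> R) M j : (forall j, 0 <= a j <= 1) ->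
  {homo a : i j / (i <= j)%N >-> j <= i} ->
  a j <= a M * 1 + 1 * (2 ^+ M * 2^-1 ^+ j).
Proof.
move=> ha hh; rewrite mulr1 mul1r exprVn.
have pos n : 0 < 2 ^+ n :> R by rewrite exprn_gt0.
case: (leqP M j) => [Mj|jM].
  by rewrite (le_trans (hh _ _ Mj))// lerDl divr_ge0// ltW.
have : 1 <= 2 ^+ M / 2 ^+ j :> R.
  by rewrite ler_pdivlMr// mul1r ler_weXn2l// ?ler1n// ltnW.
by have := ha j; have := ha M; lra.
Qed.

(** Fewer than [M] successes before many failures are exponentially unlikely. The probability that
    the [k]-th failure occurs at all is kept as a factor, because it is what [finite_exc1] exploits
    later. *)
Lemma nexp_tail {R : realType} (p a : nat -> R) M f k : right_seq p ->
  (forall j, 0 <= a j <= 1) -> {homo a : i j / (i <= j)%N >-> j <= i} ->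
  nexp p a f k <= a M * nexp p (fun=> 1) f k + 2 ^+ M * (2 / 3) ^+ k.
Proof.
move=> hp ha hh.
have := nexp_le _ _ _ f k (right_prob_seq _ hp) (fun j _ => anti_le_pow a M j ha hh).
move/le_trans; apply; rewrite nexp_lin lerD2l mul1r.
by apply: nexp_pow => //; rewrite exprn_ge0.
Qed.

Lemma bexp_tail {R : realType} (p a : nat -> R) M k : right_seq p ->
  (forall j, 0 <= a j <= 1) -> {homo a : i j / (i <= j)%N >-> j <= i} ->
  bexp p a k <= a M + 2 ^+ M * (3 / 4) ^+ k.
Proof.
move=> hp ha hh.
have := bexp_le _ _ _ k (right_prob_seq _ hp) (fun j => anti_le_pow a M j ha hh).
move/le_trans; apply; rewrite bexp_lin bexp_cst mulr1 lerD2l mul1r.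
by apply: bexp_pow => //; rewrite exprn_ge0.
Qed.

Lemma cvg_nexp {R : realType} (p : nat -> R) (a : nat -> nat -> R) (b : nat -> R) f k :
  (forall j, a ^~ j @ \oo --> b j) -> (fun n => nexp p (a n) f k) @ \oo --> nexp p b f k.
Proof.
elim: f p a b k => [|f IH] p a b [|k] hab /=; try exact: hab; first exact: cvg_cst.
apply: cvgD; apply: cvgMr; last exact: IH.
by apply: (IH _ (fun n j => a n j.+1)) => j; exact: hab.
Qed.

Lemma cvg_bexp {R : realType} (p : nat -> R) (a : nat -> nat -> R) (b : nat -> R) k :
  (forall j, a ^~ j @ \oo --> b j) -> (fun n => bexp p (a n) k) @ \oo --> bexp p b k.
Proof.
elim: k p a b => [|k IH] p a b hab /=; first exact: hab.
apply: cvgD; apply: cvgMr; last exact: IH.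
by apply: (IH _ (fun n j => a n j.+1)) => j; exact: hab.
Qed.

Lemma measurable_nexp {d} {T : measurableType d} {R : realType} (p a : T -> nat -> R) f k :
  (forall i, measurable_fun setT (p ^~ i)) -> (forall j, measurable_fun setT (a ^~ j)) ->
  measurable_fun setT (fun t => nexp (p t) (a t) f k).
Proof.
elim: f p a k => [|f IH] p a [|k] hp ha /=; try exact: ha.
  exact: measurable_cst.
apply: measurable_funD; apply: measurable_funM.
- exact: hp.
- by apply: (IH (fun t i => p t i.+1) (fun t j => a t j.+1)).
- by apply: measurable_funB; [exact: measurable_cst|exact: hp].
- by apply: (IH (fun t i => p t i.+1)).
Qed.

(** * The excursion chain with bounded fuel and height *)

(* Level [i] stands for the site [y + 1 + i], with cookie stack [p i] of which
   only the first [f i] may be used, and the walker is at [y + l]. This is the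
   probability that the walker comes back to [y] and that [k] further excursions
   to the right of [y] are finite, all without reaching level [H]. A walker at or
   above a level makes one more jump down from it than up to it, whence [0 < l]. *)
Fixpoint extinct {R : realType} (p : nat -> nat -> R) (f : nat -> nat) (l H k : nat)
    {struct H} : R :=
  if H is H'.+1 then
    nexp (p 0%N) (extinct (fun i => p i.+1) (fun i => f i.+1) l.-1 H') (f 0%N)
      (k + (0 < l))
  else (k + (0 < l) == 0)%N%:R.

Lemma extinct_bounds {R : realType} (p : nat -> nat -> R) f l H k :
  (forall i, prob_seq (p i)) -> 0 <= extinct p f l H k <= 1.
Proof.
elim: H p f l k => [|H IH] p f l k hp /=; first by rewrite ler0n lern1 leq_b1.
have hp' i : prob_seq (p i.+1) by exact: hp.
have IH' := IH _ (fun i => f i.+1) l.-1 _ hp'.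
apply/andP; split; first by apply: nexp_ge0 => // j; case/andP: (IH' j).
by apply: nexp_le_cst => // j; case/andP: (IH' j).
Qed.

Lemma extinct_ge0 {R : realType} (p : nat -> nat -> R) f l H k :
  (forall i, prob_seq (p i)) -> 0 <= extinct p f l H k.
Proof. by move=> hp; case/andP: (extinct_bounds p f l H k hp). Qed.

Lemma extinct_le1 {R : realType} (p : nat -> nat -> R) f l H k :
  (forall i, prob_seq (p i)) -> extinct p f l H k <= 1.
Proof. by move=> hp; case/andP: (extinct_bounds p f l H k hp). Qed.

Lemma extinct00 {R : realType} (p : nat -> nat -> R) f H : extinct p f 0 H 0 = 1.
Proof. by elim: H p f => [|H IH] p f //=; rewrite nexpk0 IH. Qed.

(** The return pending from [y + 1] is the same as one more excursion to come. *)
Lemma extinct1 {R : realType} (p : nat -> nat -> R) f H k :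
  extinct p f 1 H k = extinct p f 0 H k.+1.
Proof. by case: H => [|H] /=; rewrite addn1 ?addn0. Qed.

Lemma extinct_anti {R : realType} (p : nat -> nat -> R) f l H :
  (forall i, prob_seq (p i)) ->
  {homo extinct p f l H : i j / (i <= j)%N >-> j <= i}.
Proof.
elim: H p f l => [|H IH] p f l hp i j ij /=.
  rewrite ler_nat; case: eqP => // jl; rewrite (_ : i + _ = 0)%N//; lia.
apply: nexp_anti => //; first by move=> k; apply: extinct_ge0 => n; exact: hp.
  by apply: IH => n; exact: hp.
by rewrite leq_add2r.
Qed.

(** The walker only adds, at every level up to its own, one failure to wait for. *)
Lemma extinct_walker_le {R : realType} (p : nat -> nat -> R) f l H k :
  (forall i, prob_seq (p i)) -> extinct p f l H k <= extinct p f 0 H k.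
Proof.
elim: H p f l k => [|H IH] p f l k hp /=.
  by rewrite ler_nat addn0; case: k => //; case: (0 < l)%N.
have hp' i : prob_seq (p i.+1) by exact: hp.
rewrite addn0; apply: (@le_trans _ _ (nexp (p 0%N)
  (extinct (fun i => p i.+1) (fun i => f i.+1) 0 H) (f 0%N) (k + (0 < l)))).
  by apply: nexp_le => // j _; apply: IH.
apply: nexp_anti => //; last exact: leq_addr.
  by move=> j; exact: extinct_ge0.
exact: extinct_anti.
Qed.

Lemma extinct_fuel {R : realType} (p : nat -> nat -> R) f g l H k :
  (forall i, prob_seq (p i)) -> (forall i, (f i <= g i)%N) ->
  extinct p f l H k <= extinct p g l H k.
Proof.
elim: H p f g l k => [|H IH] p f g l k hp fg //=.
have hp' i : prob_seq (p i.+1) by exact: hp.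
apply: (@le_trans _ _ (nexp (p 0%N)
  (extinct (fun i => p i.+1) (fun i => f i.+1) l.-1 H) (g 0%N) (k + (0 < l)))).
  by apply: nexp_fuel => // j; exact: extinct_ge0.
by apply: nexp_le => // j _; apply: IH.
Qed.

Lemma extinct_height {R : realType} (p : nat -> nat -> R) f l H k :
  (forall i, prob_seq (p i)) -> extinct p f l H k <= extinct p f l H.+1 k.
Proof.
elim: H p f l k => [|H IH] p f l k hp.
  case: l k => [|l] [|k]; rewrite /= ?addn0 ?addn1 ?nexpk0 //=;
    apply: nexp_ge0 => // j; exact: ler0n.
rewrite [leLHS]/= [leRHS](_ : _ = nexp (p 0%N)
  (extinct (fun i => p i.+1) (fun i => f i.+1) l.-1 H.+1) (f 0%N) (k + (0 < l)))//.
by apply: nexp_le => // j _; apply: IH => i; exact: hp.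
Qed.

Lemma extinct_heights {R : realType} (p : nat -> nat -> R) f l H H' k :
  (forall i, prob_seq (p i)) -> (H <= H')%N ->
  extinct p f l H k <= extinct p f l H' k.
Proof.
move=> hp /subnKC <-; elim: (H' - H)%N => [|n IH]; first by rewrite addn0.
by rewrite addnS (le_trans IH)// extinct_height.
Qed.

Lemma extinct_beyond {R : realType} (p : nat -> nat -> R) f l H k :
  (H < l)%N -> extinct p f l H k = 0.
Proof.
elim: H p f l k => [|H IH] p f [|l] k //= Hl; first by rewrite addn1.
rewrite (_ : extinct _ _ _ _ = fun=> 0) ?nexp0//.
by apply/funext => j; apply: IH.
Qed.

(** The walker stands at level [l], which without fuel cannot produce the failure that brings it
    down. *)
Lemma extinct_out_of_fuel {R : realType} (p : nat -> nat -> R) f l H k :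
  f l = 0%N -> extinct p f l.+1 H k = 0.
Proof.
elim: H p f l k => [|H IH] p f l k fl /=; first by rewrite addn1.
case: l fl => [|l] fl; first by rewrite fl addn1.
rewrite (_ : extinct _ _ _ _ = fun=> 0) ?nexp0//.
by apply/funext => j; apply: IH.
Qed.

(** The first trial of [nexp] at the walker's own level is the walker's next step; the lower levels
    merely average over this, and [nexp] is linear in its weight. The shifted stacks [q] and [g]
    enter through equations, to be matched extensionally at each use. *)
Lemma extinct_step {R : realType} (p q : nat -> nat -> R) f g l H k :
  (l < H)%N -> (0 < f l)%N ->
  q = (fun i n => p i ((i == l) + n)%N) -> g = (fun i => f i - (i == l))%N ->
  extinct p f l.+1 H k =
    p l 0%N * extinct q g l.+2 H k + (1 - p l 0%N) * extinct q g l H k.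
Proof.
elim: l p q f g H k => [|l IH] p q f g [|H] k // lH fl -> ->.
  rewrite /= addn1 addn0 subn1.
  have -> : (fun i => f i.+1 - (i.+1 == 0))%N = (fun i => f i.+1).
    by apply/funext => i; rewrite subn0.
  case: (f 0%N) fl => // f0 _ /=.
  congr (_ * _ + _).
  by congr nexp; apply/funext => j; rewrite -extinct1.
rewrite /= addn1 subn0.
set a := extinct _ _ l.+1 H; set b := extinct _ _ l.+2 H.
set c := extinct _ _ l H.
have -> : a = fun j => p l.+1 0%N * b j + (1 - p l.+1 0%N) * c j.
  by apply/funext => j; apply: IH.
exact: nexp_lin.
Qed.

(** * Finite-time visit probabilities of the walk *)

(* Probability of at least [m] visits to [y] at times [0..n] by the walk which is
   at [x] and has visited the sites [h] before. *)
Fixpoint visit_prob {R : realType} (w : env R) (y : int) (n : nat)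
    (h : seq int) (x : int) (m : nat) : R :=
  if n is n'.+1 then
    let p := w x (count (pred1 x) h) in
    p * visit_prob w y n' (x :: h) (x + 1) (m - (x == y))
    + (1 - p) * visit_prob w y n' (x :: h) (x - 1) (m - (x == y))
  else (m <= (x == y))%N%:R.

Lemma sum_path_prob {R : realType} (w : env R) (y : int) n h x m :
  \sum_(s : n.-tuple bool | (m <= count (pred1 y) (positions x s))%N)
     path_prob w h x s = visit_prob w y n h x m.
Proof.
elim: n h x m => [|n IH] h x m /=.
  rewrite big_mkcond (big_pred1 [tuple]) /=; last by move=> s; rewrite (tuple0 s) /= eqxx.
  by rewrite addn0; case: leq.
rewrite (reindex (fun bs : bool * n.-tuple bool => [tuple of bs.1 :: bs.2])) /=; last first.
  exists (fun s : n.+1.-tuple bool => (thead s, [tuple of behead s])).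
    by move=> [b s] _ /=; congr pair; apply/val_inj.
  by move=> s _; rewrite [RHS](tuple_eta s).
rewrite -(pair_big_dep predT (fun b (s : n.-tuple bool) =>
   (m <= (x == y) + count (pred1 y) (positions (step x b) s))%N)
   (fun b (s : n.-tuple bool) => (if b then w x (count (pred1 x) h)
      else 1 - w x (count (pred1 x) h)) * path_prob w (x :: h) (step x b) s)) /=.
rewrite big_bool /=; congr (_ + _); rewrite -big_distrr /= -IH;
  by congr (_ * _); apply: eq_bigl => s; rewrite leq_subLR.
Qed.

Lemma visit_prob_bounds {R : realType} (w : env R) y n h x m :
  (forall z k, 0 <= w z k <= 1) -> 0 <= visit_prob w y n h x m <= 1.
Proof.
move=> hw; elim: n h x m => [|n IH] h x m /=; first by rewrite ler0n lern1 leq_b1.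
have /andP[a0 a1] := IH (x :: h) (x + 1) (m - (x == y))%N.
have /andP[b0 b1] := IH (x :: h) (x - 1) (m - (x == y))%N.
move: a0 a1 b0 b1; set a := visit_prob _ _ _ _ _ _; set b := visit_prob _ _ _ _ _ _.
have /andP[p0 p1] := hw x (count (pred1 x) h).
set p := w _ _ in p0 p1 *.
have q0 : 0 <= 1 - p by lra.
move=> a0 a1 b0 b1; rewrite addr_ge0 ?mulr_ge0//=.
have : p * a <= p * 1 by apply: ler_wpM2l.
have : (1 - p) * b <= (1 - p) * 1 by apply: ler_wpM2l.
by lra.
Qed.

Lemma visit_prob0 {R : realType} (w : env R) y n h x : visit_prob w y n h x 0 = 1.
Proof. by elim: n h x => [|n IH] h x //=; rewrite !IH; ring. Qed.

Lemma visit_prob1 {R : realType} (w : env R) y n h : visit_prob w y n h y 1 = 1.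
Proof.
case: n h => [|n] h /=; first by rewrite eqxx.
by rewrite eqxx subnn !visit_prob0; ring.
Qed.

(** * The harmonic function of the killed walk, and the upper bound *)

Definition cookies_above {R : realType} (w : env R) (y : int) (h : seq int) (i k : nat) : R :=
  w (y + 1 + i%:Z) (count (pred1 (y + 1 + i%:Z)%R) h + k)%N.

Definition fuel_above (y : int) (L : nat) (h : seq int) (i : nat) : nat :=
  (L - count (pred1 (y + 1 + i%:Z)%R) h)%N.

Definition dist_above (y x : int) : nat := if x <= y then 0%N else `|x - y|%N.

(* Probability, for the walk killed at its [L.+1]-th visit to a site above [y]
   and at [y + H + 1], and returning to [y] from the left surely, that the
   [m]-th visit to [y] from now on happens ([m >= 1]). *)
Definition killed_visit_prob {R : realType} (w : env R) (y : int) (L H : nat)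
    (h : seq int) (x : int) (m : nat) : R :=
  bexp (fun k => w y (count (pred1 y) h + k)%N)
    (extinct (cookies_above w y h) (fuel_above y L h) (dist_above y x) H) m.-1.

Lemma dist_above0 y x : x <= y -> dist_above y x = 0%N.
Proof. by rewrite /dist_above => ->. Qed.

Lemma dist_aboveS y l : dist_above y (y + 1 + l%:Z) = l.+1.
Proof. by rewrite /dist_above; case: ifP => ?; lia. Qed.

Lemma cookies_above_low {R : realType} (w : env R) y h x : x <= y ->
  cookies_above w y (x :: h) = cookies_above w y h.
Proof.
move=> xy; apply/funext => i; apply/funext => k; rewrite /cookies_above /=.
by have /negbTE-> : x != y + 1 + i%:Z by lia.
Qed.

Lemma fuel_above_low y L h x : x <= y -> fuel_above y L (x :: h) = fuel_above y L h.
Proof.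
move=> xy; apply/funext => i; rewrite /fuel_above /=.
by have /negbTE-> : x != y + 1 + i%:Z by lia.
Qed.

(** To the left of [y] a return is taken for granted, so neither the position nor the cookies used
    there matter. *)
Lemma killed_left {R : realType} (w : env R) y L H h x x' m : x < y -> x' <= y ->
  killed_visit_prob w y L H (x :: h) x' m = killed_visit_prob w y L H h x m.
Proof.
move=> xy xy'; rewrite /killed_visit_prob /=.
have /negbTE-> : x != y by lia.
by rewrite cookies_above_low ?fuel_above_low ?dist_above0 // ltW.
Qed.

(** A departure from [y] is one trial of [bexp]; after a success, [extinct1] treats the walker at
    [y + 1] as one more excursion. *)
Lemma killed_at {R : realType} (w : env R) y L H h m :
  let p := w y (count (pred1 y) h) in
  killed_visit_prob w y L H h y m.+2 =
  p * killed_visit_prob w y L H (y :: h) (y + 1) m.+1 +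
  (1 - p) * killed_visit_prob w y L H (y :: h) (y - 1) m.+1.
Proof.
rewrite /killed_visit_prob /= eqxx !cookies_above_low// !fuel_above_low// addn0.
have -> : dist_above y (y + 1) = 1%N by rewrite -(dist_aboveS y 0) addr0.
rewrite !dist_above0//; last by lia.
set a := extinct _ _ 0 H; set b := extinct _ _ 1 H.
have -> : b = (fun j => a j.+1) by apply/funext => j; exact: extinct1.
by congr (_ * bexp _ _ _ + _ * bexp _ _ _); apply/funext => i; rewrite addnS add1n addSn.
Qed.

(** This is [extinct_step] averaged by the linear [bexp]. With [killed_left] and [killed_at] it
    makes the function harmonic until the walk is killed. *)
Lemma killed_above {R : realType} (w : env R) y L H h l m :
  let x := y + 1 + l%:Z in
  let p := w x (count (pred1 x) h) in
  (l < H)%N -> (count (pred1 x) h < L)%N ->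
  killed_visit_prob w y L H h x m =
  p * killed_visit_prob w y L H (x :: h) (x + 1) m +
  (1 - p) * killed_visit_prob w y L H (x :: h) (x - 1) m.
Proof.
move=> x p lH fuel; rewrite /killed_visit_prob -bexp_lin /=.
have /negbTE-> : x != y by rewrite /x; lia.
have -> : x + 1 = y + 1 + l.+1%:Z by rewrite /x; lia.
have -> : dist_above y (x - 1) = l.
  by rewrite /dist_above /x; case: ifP => ?; lia.
rewrite !dist_aboveS; congr bexp; apply/funext => j.
rewrite (@extinct_step _ _ (cookies_above w y (x :: h)) _ (fuel_above y L (x :: h)))//.
- by rewrite /cookies_above -/x addn0.
- by rewrite /fuel_above -/x subn_gt0.
- apply/funext => i; apply/funext => k; rewrite /cookies_above /x /=.
  have -> : (y + 1 + l%:Z == y + 1 + i%:Z) = (i == l) by lia.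
  by congr w; lia.
- apply/funext => i; rewrite /fuel_above /x /=.
  have -> : (y + 1 + l%:Z == y + 1 + i%:Z) = (i == l) by lia.
  by lia.
Qed.

Lemma killed_last {R : realType} (w : env R) y L H h : killed_visit_prob w y L H h y 1 = 1.
Proof. by rewrite /killed_visit_prob /= dist_above0// extinct00. Qed.

Lemma gt_above_site (x y : int) : y < x -> exists l : nat, x = y + 1 + l%:Z.
Proof. by exists `|(x - y - 1)%R|%N; lia. Qed.

Lemma killed_bounds {R : realType} (w : env R) y L H h x m :
  (forall z k, 0 <= w z k <= 1) -> 0 <= killed_visit_prob w y L H h x m <= 1.
Proof.
move=> hw; rewrite /killed_visit_prob; set p := (fun k => _); set a := extinct _ _ _ _.
have hp : prob_seq p by move=> i; exact: hw.
have ha j : 0 <= a j <= 1 by apply: extinct_bounds => i k; exact: hw.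
apply/andP; split.
  by rewrite -[leLHS](bexp_cst p 0 m.-1); apply: bexp_le => // j; case/andP: (ha j).
by rewrite -[leRHS](bexp_cst p 1 m.-1); apply: bexp_le => // j; case/andP: (ha j).
Qed.

(** Within [n] steps neither fuel nor height can be exhausted, so harmonicity propagates the
    comparison. With no step left it is trivial unless the last required visit is taking place,
    where the right side is 1. *)
Lemma visit_prob_le_killed {R : realType} (w : env R) y L H n h x m :
  (forall z k, 0 <= w z k <= 1) -> (forall z, (count (pred1 z) h + n <= L)%N) ->
  x + n%:Z <= y + H%:Z -> (0 < m)%N ->
  visit_prob w y n h x m <= killed_visit_prob w y L H h x m.
Proof.
move=> hw; elim: n h x m => [|n IH] h x [|m] // hL hH _.
  rewrite /visit_prob; case: eqP => [->|_]; last first.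
    by case/andP: (killed_bounds w y L H h x m.+1 hw).
  case: m => [|m]; first by rewrite killed_last.
  by case/andP: (killed_bounds w y L H h y m.+2 hw).
have hL' z : (count (pred1 z) (x :: h) + n <= L)%N.
  rewrite (leq_trans _ (hL z))//= addnS -addSn leq_add2r.
  by case: (x == z); rewrite ?add0n ?leqnSn.
have hR : (x + 1) + n%:Z <= y + H%:Z by lia.
have hl : (x - 1) + n%:Z <= y + H%:Z by lia.
have [xy|yx|xy] := ltgtP x y.
- have /negbTE xney : x != y by lia.
  rewrite /= xney subn0.
  rewrite [leRHS](_ : killed_visit_prob w y L H h x m.+1 =
     w x (count (pred1 x) h) * killed_visit_prob w y L H (x :: h) (x + 1) m.+1 +
     (1 - w x (count (pred1 x) h)) * killed_visit_prob w y L H (x :: h) (x - 1) m.+1).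
    by apply: ler_conv => //; apply: IH.
  by rewrite !killed_left//; [ring|lia|lia].
- have [l xE] : exists l : nat, x = y + 1 + l%:Z by exact: gt_above_site.
  have /negbTE xney : x != y by lia.
  rewrite {2}xE killed_above -?xE /= ?xney ?subn0.
  + by apply: ler_conv => //; apply: IH.
  + by lia.
  + by apply: leq_trans (hL x); rewrite addnS ltnS leq_addr.
- subst x; case: m => [|m]; first by rewrite visit_prob1 killed_last.
  rewrite killed_at /= eqxx subn1.
  by apply: ler_conv => //; apply: IH.
Qed.

(** * The lower bound for the visit probabilities *)

Definition fuel_left (y : int) (L H : nat) (h : seq int) : nat :=
  (\sum_(i < H) fuel_above y L h i)%N.

Lemma fuel_left_low y L H h x : x <= y -> fuel_left y L H (x :: h) = fuel_left y L H h.
Proof. by move=> xy; rewrite /fuel_left fuel_above_low. Qed.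

(** Each step taken above [y] burns one unit, so [fuel_left] bounds the time spent there before
    killing. *)
Lemma fuel_left_above y L H h l : let x := y + 1 + l%:Z in
  (l < H)%N -> (count (pred1 x) h < L)%N ->
  fuel_left y L H h = (fuel_left y L H (x :: h)).+1.
Proof.
move=> x lH fuel; rewrite /fuel_left (bigD1 (Ordinal lH)) //= [in RHS](bigD1 (Ordinal lH)) //=.
rewrite -addSn; congr addn.
  by rewrite /fuel_above /= eqxx add1n subnSK.
apply: eq_bigr => i il; rewrite /fuel_above /=.
by have /negbTE-> : x != y + 1 + i%:Z by move: il; rewrite /x -val_eqE /=; lia.
Qed.

Lemma dist_above_left x y : x < y ->
  dist_above x y = (dist_above (x + 1) y).+1 /\ dist_above (x - 1) y = (dist_above x y).+1.
Proof. by rewrite /dist_above => ?; split; do !case: ifP => ?; lia. Qed.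

Lemma dist_above_pred x y : y < x -> dist_above (x - 1) y = 0%N.
Proof. by move=> ?; rewrite dist_above0//; lia. Qed.

Lemma dist_above_at y : dist_above (y - 1) y = 1%N.
Proof. by rewrite /dist_above; case: ifP; lia. Qed.

(* Supermartingale-type correction: [(m + r) / N] accounts for escaping to
   [y - N] during one of the excursions to the left of [y] ([r = y - x] there),
   and the function after [d] decreases by at least one at each step in mean, so
   that [d] times it pays for not being done at time [n <= 1 / d]. *)
Lemma killed_le_visit_prob {R : realType} (w : env R) y L H N (c d : R) n h x m :
  (forall z k, 2^-1 <= w z k <= 1) -> (0 < N)%N -> c * N%:R = 1 -> 0 <= d ->
  d * n%:R <= 1 -> (0 < m)%N -> (dist_above x y <= N)%N ->
  killed_visit_prob w y L H h x m - (m%:R + (dist_above x y)%:R) * c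
  - d * ((fuel_left y L H h)%:R + 2 * N%:R * m%:R
         + (dist_above x y)%:R * (2 * N%:R - (dist_above x y)%:R))
  - 1 + d * n%:R
  <= visit_prob w y n h x m.
Proof.
move=> hw N0 cN d0.
have hw' z k : 0 <= w z k <= 1 by have := hw z k; lra.
have c0 : 0 <= c.
  by rewrite -(@pmulr_lge0 _ N%:R) ?ltr0n// cN.
have N1 : 1 <= N%:R :> R by rewrite ler1n.
elim: n h x m => [|n IH] h x [|m] // hn _ rN; set r := (dist_above x y)%:R.
  (* With no time left, the term [- 1] outweighs [killed_visit_prob], so the left side is at most
     0. *)
  have /andP[v0 _] := visit_prob_bounds w y 0 h x m.+1 hw'.
  have /andP[_ k1] := killed_bounds w y L H h x m.+1 hw'.
  apply: le_trans v0; rewrite mulr0.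
  have : 0 <= (m.+1%:R + r) * c by rewrite mulr_ge0// addr_ge0 ?ler0n.
  have : 0 <= d * ((fuel_left y L H h)%:R + 2 * N%:R * m.+1%:R + r * (2 * N%:R - r)).
    rewrite mulr_ge0// !addr_ge0 ?mulr_ge0 ?ler0n//.
    by have : r <= N%:R; [rewrite ler_nat|lra].
  by lra.
have rN' : r <= N%:R by rewrite ler_nat.
have r0 : 0 <= r by rewrite ler0n.
have hn' : d * n%:R <= 1 by move: hn; rewrite -natr1; lra.
have T0 : 0 <= d * ((fuel_left y L H h)%:R + 2 * N%:R * m.+1%:R + r * (2 * N%:R - r)).
  by rewrite mulr_ge0// !addr_ge0 ?mulr_ge0 ?ler0n//; lra.
have e0 : 0 <= (m.+1%:R + r) * c by rewrite mulr_ge0// addr_ge0 ?ler0n.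
have /andP[v0 v1] := visit_prob_bounds w y n.+1 h x m.+1 hw'.
have /andP[k0 k1] := killed_bounds w y L H h x m.+1 hw'.
set F := (fuel_left y L H h)%:R in T0 *.
have := hw x (count (pred1 x) h).
have [xy|yx|xy] := ltgtP x y.
- have xney : (x == y) = false by rewrite lt_eqF.
  have [rp rm] := dist_above_left _ _ xy.
  (* At [y - N] the correction [r * c] is 1, which again makes the left side at most 0. *)
  have [reN|rneN] := eqVneq (dist_above x y) N.
    move=> _; apply: le_trans v0.
    have : 1 <= (m.+1%:R + r) * c.
      rewrite /r reN mulrDl [_%:R * c]mulrC (mulrC N%:R) cN lerDr mulr_ge0//.
    by lra.
  have rpN : (dist_above (x + 1) y <= N)%N by rewrite (leq_trans _ rN)// rp.
  have rmN : (dist_above (x - 1) y <= N)%N by rewrite rm ltn_neqAle rneN.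
  have xy1 : x + 1 <= y by rewrite lezD1.
  have xy2 : x - 1 <= y by rewrite ltW// ltrBlDr (lt_trans xy)// ltrDl.
  have := IH (x :: h) (x + 1) m.+1 hn' isT rpN.
  have := IH (x :: h) (x - 1) m.+1 hn' isT rmN.
  rewrite /= xney subn0 !killed_left//.
  rewrite fuel_left_low ?(ltW xy)// -/F rm.
  have -> : (dist_above (x + 1) y)%:R = r - 1 by rewrite /r rp -natr1; ring.
  rewrite -[(dist_above x y).+1%:R]natr1 -/r.
  set p := w _ _; set K := killed_visit_prob _ _ _ _ _ _ _.
  set a := visit_prob _ _ _ _ _ _; set b := visit_prob _ _ _ _ _ _.
  move=> hb ha hp.
  have q0 : 0 <= 1 - p by lra.
  have p0 : 0 <= p by lra.
  have := lerD (ler_wpM2l p0 ha) (ler_wpM2l q0 hb).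
  apply: le_trans; rewrite -subr_ge0 -[n.+1%:R]natr1.
  (* In mean [r] changes by [-(2p - 1)] and [r (2N - r)] by [-1 - 2 (2p - 1) (N - r)]; [e1] and [e2]
     are the surplus over the required decrease. *)
  have e1 : 0 <= (2 * p - 1) * c by rewrite mulr_ge0//; lra.
  have e2 : 0 <= d * ((2 * p - 1) * (2 * (N%:R - r))).
    by rewrite mulr_ge0// mulr_ge0//; lra.
  apply: le_trans (addr_ge0 e1 e2) _.
  by rewrite le_eqVlt; apply/orP; left; apply/eqP; ring.
- have [l xE] : exists l : nat, x = y + 1 + l%:Z by exact: gt_above_site.
  have xney : (x == y) = false by rewrite gt_eqF.
  have rE : dist_above x y = 0%N by rewrite dist_above0// ltW.
  have rzero : r = 0 by rewrite /r rE.
  (* A walk beyond the height, or in the next case out of fuel, is killed, so [killed_visit_prob]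
     vanishes. *)
  have [Hl|lH] := leqP H l.
    move=> _; apply: le_trans v0.
    have -> : killed_visit_prob w y L H h x m.+1 = 0.
      rewrite /killed_visit_prob xE dist_aboveS.
      rewrite (_ : extinct _ _ _ _ = fun=> 0) ?bexp_cst//.
      by apply/funext => j; rewrite extinct_beyond.
    by lra.
  have [Lc|cL] := leqP L (count (pred1 x) h).
    move=> _; apply: le_trans v0.
    have -> : killed_visit_prob w y L H h x m.+1 = 0.
      rewrite /killed_visit_prob xE dist_aboveS.
      rewrite (_ : extinct _ _ _ _ = fun=> 0) ?bexp_cst//.
      apply/funext => j; rewrite extinct_out_of_fuel// /fuel_above -xE.
      by apply/eqP; rewrite subn_eq0.
    by lra.
  have rp : dist_above (x + 1) y = 0%N by rewrite dist_above0// ler_wpDr// ltW.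
  have rm : dist_above (x - 1) y = 0%N by exact: dist_above_pred.
  have := IH (x :: h) (x + 1) m.+1 hn' isT ltac:(by rewrite rp).
  have := IH (x :: h) (x - 1) m.+1 hn' isT ltac:(by rewrite rm).
  have FE : (fuel_left y L H (x :: h))%:R = F - 1.
    have fE : fuel_left y L H h = (fuel_left y L H (x :: h)).+1.
      by rewrite xE; apply: (@fuel_left_above _ _ _ _ l) => //; rewrite -xE.
    by rewrite /F fE -natr1; ring.
  rewrite rp rm FE rzero.
  have -> : killed_visit_prob w y L H h x m.+1 =
     w x (count (pred1 x) h) * killed_visit_prob w y L H (x :: h) (x + 1) m.+1 +
     (1 - w x (count (pred1 x) h)) * killed_visit_prob w y L H (x :: h) (x - 1) m.+1.
    by rewrite {1}xE killed_above -?xE.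
  rewrite /= xney subn0.
  set p := w _ _; set K := killed_visit_prob _ _ _ _ _ _ _.
  set K' := killed_visit_prob _ _ _ _ _ _ _.
  set a := visit_prob _ _ _ _ _ _; set b := visit_prob _ _ _ _ _ _.
  move=> hb ha hp.
  have q0 : 0 <= 1 - p by lra.
  have p0 : 0 <= p by lra.
  have := lerD (ler_wpM2l p0 ha) (ler_wpM2l q0 hb).
  apply: le_trans; rewrite le_eqVlt; apply/orP; left; apply/eqP.
  by rewrite -[n.+1%:R]natr1; ring.
- subst x; case: m hn rN T0 e0 v0 v1 k0 k1 => [|m] hn rN T0 e0 v0 v1 k0 k1.
    by rewrite visit_prob1; lra.
  have rE : dist_above y y = 0%N by rewrite dist_above0.
  have rzero : r = 0 by rewrite /r rE.
  have rp : dist_above (y + 1) y = 0%N by rewrite dist_above0// lerDl.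
  have rm := dist_above_at y.
  have := IH (y :: h) (y + 1) m.+1 hn' isT ltac:(by rewrite rp).
  have := IH (y :: h) (y - 1) m.+1 hn' isT ltac:(by rewrite rm).
  rewrite killed_at !fuel_left_low// rp rm -/F rzero /= eqxx subn1 /=.
  set p := w _ _; set K := killed_visit_prob _ _ _ _ _ _ _.
  set K' := killed_visit_prob _ _ _ _ _ _ _.
  set a := visit_prob _ _ _ _ _ _; set b := visit_prob _ _ _ _ _ _.
  move=> hb ha hp.
  have q0 : 0 <= 1 - p by lra.
  have p0 : 0 <= p by lra.
  have := lerD (ler_wpM2l p0 ha) (ler_wpM2l q0 hb).
  apply: le_trans; rewrite -subr_ge0 -[n.+1%:R]natr1 -[m.+2%:R]natr1.
  (* The visit spent releases [c] and [2N], of which a step to the left takes back [c] and [2N - 1].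
     The mean surplus is [p c] and, beyond the required 1, [p (2N - 1)]. *)
  have e1 : 0 <= p * c by rewrite mulr_ge0.
  have e2 : 0 <= d * (p * (2 * N%:R - 1)) by rewrite mulr_ge0// mulr_ge0//; lra.
  apply: le_trans (addr_ge0 e1 e2) _.
  by rewrite le_eqVlt; apply/orP; left; apply/eqP; ring.
Qed.

(** * Suprema, infima and limits of real sequences *)

Lemma le_sup_range {R : realType} (f : nat -> R) n :
  (forall n, f n <= 1) -> f n <= sup (range f).
Proof.
by move=> f1; apply: ub_le_sup; [exists 1 => _ [i _ <-]; exact: f1|exists n].
Qed.

Lemma sup_range_le {R : realType} (f : nat -> R) c :
  (forall n, f n <= c) -> sup (range f) <= c.
Proof.
by move=> fc; apply: ge_sup; [exists (f 0%N), 0%N|move=> _ [i _ <-]; exact: fc].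
Qed.

Lemma inf_range_le {R : realType} (f : nat -> R) n :
  (forall n, 0 <= f n) -> inf (range f) <= f n.
Proof.
by move=> f0; apply: ge_inf; [exists 0 => _ [i _ <-]; exact: f0|exists n].
Qed.

Lemma le_inf_range {R : realType} (f : nat -> R) c :
  (forall n, c <= f n) -> c <= inf (range f).
Proof.
by move=> fc; apply: lb_le_inf; [exists (f 0%N), 0%N|move=> _ [i _ <-]; exact: fc].
Qed.

Lemma le_of_vanishing {R : realType} (A B S : R) (g : nat -> R) m0 :
  g @ \oo --> 0 -> (forall m, (m0 <= m)%N -> S <= A + B * g m) -> S <= A.
Proof.
move=> g0 h.
have cv : (fun m => A + B * g m) @ \oo --> A + B * 0.
  by apply: cvgD; [exact: cvg_cst|apply: cvgMr].
rewrite mulr0 addr0 in cv; apply: (cvgr_to_ge cv).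
by exists m0 => // m /= ?; exact: h.
Qed.

Lemma le_of_geometric {R : realType} (A B S z : R) m0 : 0 <= z < 1 ->
  (forall m, (m0 <= m)%N -> S <= A + B * z ^+ m) -> S <= A.
Proof.
move=> /andP[z0 z1]; apply: le_of_vanishing.
by apply: cvg_expr; rewrite ger0_norm.
Qed.

(** * Extinction probabilities without bounds on fuel and height *)

Definition right_env {R : realType} (u : seqenv R) := forall x, right_seq (u x).

Lemma right_env_prob {R : realType} (u : seqenv R) : right_env u ->
  forall x, prob_seq (u x).
Proof. by move=> hu x; apply: right_prob_seq. Qed.

Lemma right_env_shift {R : realType} (u : seqenv R) :
  right_env u -> right_env (seq_shift u).
Proof. by move=> hu x; exact: hu. Qed.

(** Fuel and height share the bound [n], so that [die] is a single monotone limit. *)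
Definition die_upto {R : realType} (u : seqenv R) (l k n : nat) : R :=
  extinct u (fun=> n) l n k.

Definition die {R : realType} (u : seqenv R) (l k : nat) : R :=
  sup (range (die_upto u l k)).

(* The quantity d(y) of the introduction, for [u] the environment above [y]. *)
Definition die_inf {R : realType} (u : seqenv R) : R := inf (range (die u 0)).

(* Probability that there are [k] failures at all. *)
Definition finite_exc {R : realType} (p : nat -> R) (k : nat) : R :=
  sup (range (fun f => nexp p (fun=> 1) f k)).

Lemma extinct_le_die_upto {R : realType} (u : seqenv R) l k L H n : right_env u ->
  (L <= n)%N -> (H <= n)%N -> extinct u (fun=> L) l H k <= die_upto u l k n.
Proof.
move=> /right_env_prob hu Ln Hn.
by apply: le_trans (extinct_fuel _ _ _ _ _ _ hu (fun=> Ln)) _; exact: extinct_heights.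
Qed.

Lemma die_upto_le1 {R : realType} (u : seqenv R) l k n : right_env u ->
  die_upto u l k n <= 1.
Proof. by move=> hu; apply: extinct_le1; exact: right_env_prob. Qed.

Lemma extinct_le_die {R : realType} (u : seqenv R) l k L H : right_env u ->
  extinct u (fun=> L) l H k <= die u l k.
Proof.
move=> hu; apply: (@le_trans _ _ (die_upto u l k (maxn L H))).
  by apply: extinct_le_die_upto; rewrite ?leq_maxl ?leq_maxr.
by apply: le_sup_range => n; exact: die_upto_le1.
Qed.

Lemma cvg_die {R : realType} (u : seqenv R) l k : right_env u ->
  die_upto u l k @ \oo --> die u l k.
Proof.
move=> hu; apply: nondecreasing_cvgn.
  by move=> m n mn; apply: extinct_le_die_upto.
by exists 1 => _ [i _ <-]; exact: die_upto_le1.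
Qed.

Lemma die_bounds {R : realType} (u : seqenv R) l k : right_env u ->
  0 <= die u l k <= 1.
Proof.
move=> hu; apply/andP; split.
  apply: le_trans (extinct_le_die u l k 0 0 hu).
  by apply: extinct_ge0; exact: right_env_prob.
by apply: sup_range_le => n; exact: die_upto_le1.
Qed.

Lemma die_ge0 {R : realType} (u : seqenv R) l k : right_env u -> 0 <= die u l k.
Proof. by move=> /(die_bounds u l k)/andP[]. Qed.

Lemma die_inf_bounds {R : realType} (u : seqenv R) : right_env u ->
  0 <= die_inf u <= 1.
Proof.
move=> hu; apply/andP; split; first by apply: le_inf_range => k; exact: die_ge0.
apply: le_trans (inf_range_le (die u 0) 0 _) _ => [k|]; first exact: die_ge0.
by case/andP: (die_bounds u 0 0 hu).
Qed.

Lemma die_inf_le {R : realType} (u : seqenv R) k : right_env u ->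
  die_inf u <= die u 0 k.
Proof. by move=> hu; apply: inf_range_le => n; exact: die_ge0. Qed.

Lemma nexp1_le {R : realType} (p : nat -> R) f k : right_seq p ->
  nexp p (fun=> 1) f k <= 1.
Proof. by move=> hp; apply: nexp_le_cst => //; exact: right_prob_seq. Qed.

Lemma nexp1_le_finite_exc {R : realType} (p : nat -> R) f k : right_seq p ->
  nexp p (fun=> 1) f k <= finite_exc p k.
Proof.
by move=> hp; apply: (@le_sup_range _ (fun f => nexp p (fun=> 1) f k)) => n; exact: nexp1_le.
Qed.

Lemma die_le {R : realType} (u : seqenv R) k c : right_env u ->
  (forall n, extinct u (fun=> n.+1) 0 n.+1 k <= c) -> die u 0 k <= c.
Proof.
move=> hu h; apply: sup_range_le => n; apply: le_trans (h n).
exact: (extinct_le_die_upto u 0 k n n n.+1 hu (leqnSn n) (leqnSn n)).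
Qed.

Lemma die_le_finite_exc {R : realType} (u : seqenv R) k : right_env u ->
  die u 0 k <= finite_exc (u 0%N) k.
Proof.
move=> hu; apply: die_le => // n; apply: le_trans (nexp1_le_finite_exc _ n.+1 _ (hu 0%N)).
rewrite [leLHS]/extinct -/(@extinct R) addn0.
apply: nexp_le => [|j _]; first exact: right_env_prob.
by apply: extinct_le1 => i; exact: right_env_prob.
Qed.

(** Up to an exponentially small probability, [k] failures come with at least [M] successes, and
    then [M] excursions have to be finite one level up. *)
Lemma die_le_shift {R : realType} (u : seqenv R) M k : right_env u ->
  die u 0 k <= die (seq_shift u) 0 M * finite_exc (u 0%N) k + 2 ^+ M * (2 / 3) ^+ k.
Proof.
move=> hu; apply: die_le => // n.
have hu' := right_env_shift _ hu.
have hp i : prob_seq (u i.+1) by exact: right_env_prob.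
rewrite [leLHS]/extinct -/(@extinct R) addn0.
apply: le_trans (nexp_tail _ _ M _ _ (hu 0%N) _ _) _.
- by move=> j; exact: extinct_bounds.
- exact: extinct_anti.
rewrite lerD2r; apply: ler_pM; first exact: extinct_ge0.
- by apply: nexp_ge0 => [|j]; [exact: right_env_prob|exact: ler01].
- exact: (extinct_le_die (seq_shift u)).
- exact: nexp1_le_finite_exc.
Qed.

Lemma finite_exc_bounds {R : realType} (p : nat -> R) k : right_seq p ->
  0 <= finite_exc p k <= 1.
Proof.
move=> hp; apply/andP; split.
  apply: le_trans (nexp1_le_finite_exc _ 0 _ hp).
  by apply: nexp_ge0 => [|j]; [exact: right_prob_seq|exact: ler01].
by apply: sup_range_le => f; exact: nexp1_le.
Qed.

Lemma finite_exc_anti {R : realType} (p : nat -> R) k k' : right_seq p ->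
  (k <= k')%N -> finite_exc p k' <= finite_exc p k.
Proof.
move=> hp kk'; apply: sup_range_le => f.
apply: le_trans (nexp1_le_finite_exc _ f _ hp).
apply: nexp_anti => //; first exact: right_prob_seq.
Qed.

Lemma die_inf_le_die_shift {R : realType} (u : seqenv R) k M : right_env u ->
  die_inf u <= die (seq_shift u) 0 M * finite_exc (u 0%N) k.
Proof.
move=> hu; have hu' := right_env_shift _ hu.
(* The number of excursions tends to infinity with [M] fixed, while [finite_exc] is frozen at [k] by
   monotonicity. *)
apply: (@le_of_geometric _ _ (2 ^+ M) _ (2 / 3) k); first lra.
move=> m km; apply: le_trans (die_inf_le _ m hu) _.
apply: le_trans (die_le_shift _ M _ hu) _; rewrite lerD2r.
by apply: ler_wpM2l; [exact: die_ge0|apply: finite_exc_anti].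
Qed.

Lemma die_inf_shift {R : realType} (u : seqenv R) : right_env u ->
  die_inf u <= die_inf (seq_shift u).
Proof.
move=> hu; have hu' := right_env_shift _ hu; apply: le_inf_range => M.
apply: le_trans (die_inf_le_die_shift _ 0 M hu) _.
have /andP[f0 f1] := finite_exc_bounds (u 0%N) 0 (hu 0%N).
by rewrite ler_piMr// die_ge0.
Qed.

(** If [k] failures had probability [F < 1], [die_inf] would grow by a factor of at least [1 / F]
    one level up; [F = 0] would force [die_inf u = 0]. *)
Lemma finite_exc1 {R : realType} (u : seqenv R) k : right_env u ->
  0 < die_inf u -> die_inf (seq_shift u) = die_inf u -> finite_exc (u 0%N) k = 1.
Proof.
move=> hu p0 pE; have hu' := right_env_shift _ hu.
have /andP[f0 f1] := finite_exc_bounds (u 0%N) k (hu 0%N).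
have fpos : 0 < finite_exc (u 0%N) k.
  rewrite lt_neqAle f0 andbT; apply/eqP => fE.
  by have := die_inf_le_die_shift _ k 0 hu; rewrite -fE mulr0; lra.
have : die_inf u / finite_exc (u 0%N) k <= die_inf (seq_shift u).
  by apply: le_inf_range => M; rewrite ler_pdivrMr// die_inf_le_die_shift.
rewrite pE ler_pdivrMr// -[leLHS]mulr1 ler_pM2l// => f2.
by apply/le_anti; rewrite f1 f2.
Qed.

(** The fuel [f] of the first level stays fixed, so [nexp] is a finite expression and commutes with
    the limit defining [die] above it. *)
Lemma die_ge {R : realType} (u : seqenv R) l f k : right_env u ->
  nexp (u 0%N) (die (seq_shift u) l.-1) f (k + (0 < l)) <= die u l k.
Proof.
move=> hu; have hu' := right_env_shift _ hu.
have hp i : prob_seq (u i.+1) by exact: right_env_prob.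
apply: (cvgr_to_le (cvg_nexp _ (fun n j => die_upto (seq_shift u) l.-1 j n) _ f
  (k + (0 < l)) (fun j => cvg_die _ l.-1 j hu'))).
exists f => // n /= fn.
apply: le_trans (extinct_le_die _ l k n.+1 n.+1 hu).
rewrite [leRHS]/extinct -/(@extinct R).
apply: (@le_trans _ _ (nexp (u 0%N) (die_upto (seq_shift u) l.-1 ^~ n) n.+1 (k + (0 < l)))).
  apply: nexp_fuel; [exact: right_env_prob| |exact: leqW].
  by move=> j; apply: extinct_ge0.
by apply: nexp_le => [|j _]; [exact: right_env_prob|apply: extinct_fuel].
Qed.

(** * A constant positive [die_inf] forces extinction *)

Definition constant_die_inf {R : realType} (p : R) (u : seqenv R) :=
  forall z, die_inf (iter z seq_shift u) = p.

(* At every level the chain is extinct or dies later with probability at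
   least [p], whatever its size: hence [1 - die <= (1 - p) (1 - die)]. *)
Lemma die_ge_mix {R : realType} (u : seqenv R) p L H k : right_env u -> 0 < p <= 1 ->
  constant_die_inf p u ->
  p + (1 - p) * extinct u (fun=> L) 0 H k <= die u 0 k.
Proof.
move=> + /andP[p0 p1]; elim: H u k => [|H IH] u k hu hc.
  case: k => [|k] /=.
    have := extinct_le_die u 0 0 0 0 hu; rewrite /= => h; lra.
  by rewrite mulr0 addr0 -(hc 0%N); exact: die_inf_le.
have hu' := right_env_shift _ hu.
have hc' : constant_die_inf p (seq_shift u) by move=> z; rewrite -iterSr; exact: hc.
have hp i : prob_seq (u i.+1) by exact: right_env_prob.
have fE : finite_exc (u 0%N) k = 1.
  by apply: finite_exc1 => //; rewrite (hc 0%N)// (hc 1%N).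
have cvF : (fun f => nexp (u 0%N) (fun=> 1) f k) @ \oo --> finite_exc (u 0%N) k.
  apply: nondecreasing_cvgn; last first.
    by exists 1 => _ [i _ <-]; apply: nexp1_le; exact: hu.
  by move=> i j ij; apply: nexp_fuel => //; exact: right_env_prob.
(* With fuel [f], only [p] times the probability of [k] failures in time is gained; as [f] grows,
   [fE] restores the full [p]. *)
have key f : (L <= f)%N ->
    p * nexp (u 0%N) (fun=> 1) f k + (1 - p) * extinct u (fun=> L) 0 H.+1 k <= die u 0 k.
  move=> Lf; have := die_ge u 0 f k hu; rewrite addn0; apply: le_trans.
  apply: (@le_trans _ _ (p * nexp (u 0%N) (fun=> 1) f k +
     (1 - p) * nexp (u 0%N) (extinct (seq_shift u) (fun=> L) 0 H) f k)).
    rewrite lerD2l ler_wpM2l ?subr_ge0//= addn0.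
    by apply: nexp_fuel => //; [exact: right_env_prob|move=> j; exact: extinct_ge0].
  rewrite -nexp_lin; apply: nexp_le => [|j _]; first exact: right_env_prob.
  by rewrite mulr1; exact: IH.
have cv : (fun f => p * nexp (u 0%N) (fun=> 1) f k +
    (1 - p) * extinct u (fun=> L) 0 H.+1 k) @ \oo -->
    p * 1 + (1 - p) * extinct u (fun=> L) 0 H.+1 k.
  apply: cvgD; last exact: cvg_cst.
  by apply: cvgMr; rewrite fE in cvF.
rewrite -[X in X + _]mulr1; apply: (cvgr_to_le cv).
by exists L => // f; exact: key.
Qed.

Lemma die1 {R : realType} (u : seqenv R) p k : right_env u -> 0 < p ->
  constant_die_inf p u -> die u 0 k = 1.
Proof.
move=> hu p0 hc.
have p1 : p <= 1 by rewrite -(hc 0%N); case/andP: (die_inf_bounds u hu).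
have /andP[d0 d1] := die_bounds u 0 k hu.
have : p + (1 - p) * die u 0 k <= die u 0 k.
  have cv : (fun n => p + (1 - p) * die_upto u 0 k n) @ \oo -->
      p + (1 - p) * die u 0 k.
    by apply: cvgD; [exact: cvg_cst|apply: cvgMr; exact: cvg_die].
  apply: (cvgr_to_le cv); exists 0%N => // n _.
  by apply: die_ge_mix => //; rewrite p0.
move=> h; apply/le_anti; rewrite d1 /=.
by rewrite -(ler_pM2l p0); lra.
Qed.

(** By induction the levels above die out surely, so only [k.+1] failures at the first level are
    needed, and these are certain because [die u 0 k.+1 = 1]. *)
Lemma die_walker1 {R : realType} (u : seqenv R) l k : right_env u ->
  (forall z k, die (iter z seq_shift u) 0 k = 1) -> die u l k = 1.
Proof.
elim: l u k => [|l IH] u k hu h; first exact: (h 0%N).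
have hu' := right_env_shift _ hu.
have dE : die (seq_shift u) l = fun=> 1.
  by apply/funext => j; apply: IH => // z n; rewrite -iterSr.
have /andP[d0 d1] := die_bounds u l.+1 k hu.
apply/le_anti; rewrite d1 /= -(h 0%N k.+1).
apply: le_trans (die_le_finite_exc _ _ hu) _.
apply: sup_range_le => f.
by have := die_ge u l.+1 f k hu; rewrite /= dE addn1.
Qed.

(** * From the excursion chain back to the walk *)

Definition env_above {R : realType} (w : env R) (y : int) : seqenv R :=
  fun i k => w (y + 1 + i%:Z) k.

Lemma right_env_above {R : realType} (w : env R) y :
  in_Omega_plus w -> right_env (env_above w y).
Proof. by move=> hw i k; exact: hw. Qed.

Lemma in_Omega_plus_prob {R : realType} (w : env R) :
  in_Omega_plus w -> forall z k, 0 <= w z k <= 1.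
Proof. by move=> hw z k; have := hw z k; lra. Qed.

Lemma killed_start {R : realType} (w : env R) y L H x m :
  killed_visit_prob w y L H [::] x m =
  bexp (w y) (extinct (env_above w y) (fun=> L) (dist_above y x) H) m.-1.
Proof.
rewrite /killed_visit_prob; congr bexp; congr extinct.
by apply/funext => i; rewrite /fuel_above subn0.
Qed.

Lemma visits_prob_bounds {R : realType} (w : env R) x y m n :
  in_Omega_plus w -> 0 <= visits_prob w x y m n <= 1.
Proof.
by move=> hw; rewrite [visits_prob _ _ _ _ _]sum_path_prob; apply: visit_prob_bounds;
   exact: in_Omega_plus_prob.
Qed.

Lemma sup_visits_bounds {R : realType} (w : env R) x y m : in_Omega_plus w ->
  0 <= sup (range (visits_prob w x y m)) <= 1.
Proof.
move=> hw; have hb n := visits_prob_bounds w x y m n hw.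
apply/andP; split; last by apply: sup_range_le => n; case/andP: (hb n).
apply: (@le_trans _ _ (visits_prob w x y m 0)); first by case/andP: (hb 0%N).
by apply: le_sup_range => n; case/andP: (hb n).
Qed.

Lemma hit_io_le {R : realType} (w : env R) x y m : in_Omega_plus w ->
  hit_io w x y <= sup (range (visits_prob w x y m)).
Proof.
move=> hw; apply: (@inf_range_le _ (fun m => sup (range (visits_prob w x y m)))) => n.
by case/andP: (sup_visits_bounds w x y n hw).
Qed.

(** Among the first [m] departures from [y] at least [M] go right, up to an exponentially small
    probability, and each opens an excursion that must be finite. *)
Lemma visits_prob_le {R : realType} (w : env R) x y m n M : in_Omega_plus w ->
  visits_prob w x y m.+1 n <= die (env_above w y) 0 M + 2 ^+ M * (3 / 4) ^+ m.
Proof.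
move=> hw; rewrite [visits_prob _ _ _ _ _]sum_path_prob.
have hu := right_env_above w y hw.
have hu' := right_env_prob _ hu.
apply: le_trans (@visit_prob_le_killed _ w y n (n + `|x - y|)%N n [::] x m.+1 _ _ _ _) _ => //.
- exact: in_Omega_plus_prob.
- by lia.
rewrite killed_start /=.
have hp : right_seq (w y) by move=> k; exact: hw.
apply: le_trans (bexp_le _ _ _ m (right_prob_seq _ hp)
  (fun j => extinct_walker_le _ _ _ _ j hu')) _.
apply: le_trans (bexp_tail _ _ M _ hp _ _) _.
- by move=> j; exact: extinct_bounds.
- exact: extinct_anti.
by rewrite lerD2r; exact: extinct_le_die.
Qed.

Lemma hit_io0 {R : realType} (w : env R) x y : in_Omega_plus w ->
  die_inf (env_above w y) = 0 -> hit_io w x y = 0.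
Proof.
move=> hw d0; apply/le_anti/andP; split; last first.
  by apply: le_inf_range => m; case/andP: (sup_visits_bounds w x y m hw).
rewrite -d0; apply: le_inf_range => M.
apply: (@le_of_geometric _ _ (2 ^+ M) _ (3 / 4) 0); first lra.
move=> m _; apply: le_trans (hit_io_le w x y m.+1 hw) _.
by apply: sup_range_le => n; exact: visits_prob_le.
Qed.

Lemma killed_le_sup_visits {R : realType} (w : env R) x y L H m : in_Omega_plus w ->
  killed_visit_prob w y L H [::] x m.+1 <= sup (range (visits_prob w x y m.+1)).
Proof.
move=> hw; set K := killed_visit_prob _ _ _ _ _ _ _; set S := sup _.
set r := dist_above x y.
have aux (k a b v s : R) : v <= s -> k - a - b - 1 + 1 <= v -> k <= s + a + b by lra.
(* Here [c] and [d] are the inverses of [N.+1] and of the horizon [s.+1], so that [d * n] is exactly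
   1 and cancels the [- 1]. *)
have key N s : (r <= N)%N ->
  K <= S + (m.+1%:R + r%:R) * N.+1%:R^-1 + ((fuel_left y L H [::])%:R
    + 2 * N.+1%:R * m.+1%:R + r%:R * (2 * N.+1%:R - r%:R)) * s.+1%:R^-1.
  move=> rN.
  have := @killed_le_visit_prob _ w y L H N.+1 N.+1%:R^-1 s.+1%:R^-1 s.+1 [::] x m.+1
    hw isT (mulVf _) _ _ isT (leqW rN).
  rewrite -/K -/r mulVf ?pnatr_eq0// invr_ge0 ler0n => /(_ isT isT (lexx _)).
  have : visit_prob w y s.+1 [::] x m.+1 <= S.
    rewrite -sum_path_prob; apply: (@le_sup_range _ (visits_prob w x y m.+1)) => n.
    by case/andP: (visits_prob_bounds w x y m.+1 n hw).
  by move=> h1 h2; rewrite [X in _ <= _ + X]mulrC; exact: aux h1 h2.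
(* The coefficient of [d] grows with [N], so the limit in [s] is taken for fixed [N], before that in
   [N]. *)
apply: (@le_of_vanishing _ S (m.+1%:R + r%:R) K _ r (@cvg_harmonic R)) => N rN.
by apply: (le_of_vanishing _ _ _ _ 0 (@cvg_harmonic R)) => s _; exact: key.
Qed.

Lemma hit_io1 {R : realType} (w : env R) x y : in_Omega_plus w ->
  (forall l k, die (env_above w y) l k = 1) -> hit_io w x y = 1.
Proof.
move=> hw d1; apply/le_anti/andP; split.
  apply: le_trans (hit_io_le w x y 0 hw) _.
  by case/andP: (sup_visits_bounds w x y 0 hw).
apply: le_inf_range => -[|m].
  rewrite -(visit_prob0 w y 0 [::] x) -sum_path_prob.
  apply: (@le_sup_range _ (visits_prob w x y 0)) => n.
  by case/andP: (visits_prob_bounds w x y 0 n hw).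
have hu := right_env_above w y hw.
have cv : (fun n => bexp (w y) (die_upto (env_above w y) (dist_above y x) ^~ n) m) @ \oo
    --> bexp (w y) (fun=> 1) m.
  apply: (cvg_bexp (w y) (fun n j => die_upto (env_above w y) (dist_above y x) j n)) => j.
  by rewrite -(d1 (dist_above y x) j); exact: cvg_die.
rewrite bexp_cst in cv; apply: (cvgr_to_le cv); exists 0%N => // n _ /=.
by have := killed_le_sup_visits w x y n n m hw; rewrite killed_start.
Qed.

(** * Measurability *)

Lemma measurable_extinct {d} {T : measurableType d} {R : realType}
    (q : T -> nat -> nat -> R) f l H k :
  (forall i n, measurable_fun setT (fun t => q t i n)) ->
  measurable_fun setT (fun t => extinct (q t) f l H k).
Proof.
elim: H q f l k => [|H IH] q f l k hq /=; first exact: measurable_cst.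
apply: (measurable_nexp (fun t => q t 0%N)); first exact: hq.
by move=> j; apply: (IH (fun t i => q t i.+1)) => i n; exact: hq.
Qed.

Lemma measurable_seq_coord {R : realType} x k :
  measurable_fun setT (fun u : SeqOmega R => u x k).
Proof.
move=> _ B mB; rewrite setTI; apply: sub_sigma_algebra.
by exists x, k, B.
Qed.

Lemma measurable_env_coord {R : realType} z k :
  measurable_fun setT (fun w : Omega R => w z k).
Proof.
move=> _ B mB; rewrite setTI; apply: sub_sigma_algebra.
by exists z, k, B.
Qed.

Lemma measurable_seq_shift {R : realType} :
  measurable_fun setT (@seq_shift R).
Proof.
apply: (@measurability _ _ _ (SeqOmega R) setT _ (@seq_coords R)) => // _ [_ [x [k [B [mB ->]]]] <-].
have := @measurable_seq_coord R x.+1 k measurableT B mB.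
by [].
Qed.

Lemma measurable_proj_nonneg {R : realType} :
  measurable_fun setT (@proj_nonneg R).
Proof.
apply: (@measurability _ _ _ (SeqOmega R) setT _ (@seq_coords R)) => // _ [_ [x [k [B [mB ->]]]] <-].
have := @measurable_env_coord R x%:Z k measurableT B mB.
by [].
Qed.

Lemma measurable_iter_shift {R : realType} z (A : set (SeqOmega R)) : measurable A ->
  measurable (iter z seq_shift @^-1` A).
Proof.
elim: z A => [|z IH] A mA //.
have := IH _ (measurable_seq_shift measurableT _ mA); rewrite setTI.
by [].
Qed.

Lemma measurable_proj_preimage {R : realType} (A : set (SeqOmega R)) : measurable A ->
  measurable (proj_nonneg @^-1` A).
Proof. by move=> /(measurable_proj_nonneg measurableT); rewrite setTI. Qed.

Lemma stationary_iter {R : realType} (P : probability (Omega R) R) z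
    (A : set (SeqOmega R)) : stationary P -> measurable A ->
  P (proj_nonneg @^-1` (iter z seq_shift @^-1` A)) = P (proj_nonneg @^-1` A).
Proof.
move=> hs mA; elim: z => [|z IH] //.
rewrite -IH [RHS]hs; last exact: measurable_iter_shift.
by congr (P _); apply/seteqP; split => w; rewrite /preimage /= -iterSr.
Qed.

(* [die_inf] is written out through countable operations because the suprema
   defining it may be junk outside of [right_env]. *)
Definition die_inf_ge {R : realType} (t : R) : set (SeqOmega R) :=
  [set u | forall m j, exists n, t - j.+1%:R^-1 < die_upto u 0 m n].

Lemma measurable_die_inf_ge {R : realType} (t : R) : measurable (die_inf_ge t).
Proof.
rewrite (_ : die_inf_ge t = \bigcap_m \bigcap_j \bigcup_n
   [set u : SeqOmega R | t - j.+1%:R^-1 < die_upto u 0 m n]); last first.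
  apply/seteqP; split => u h.
    by move=> m _ j _; have [n hn] := h m j; exists n.
  by move=> m j; have [n _ hn] := h m I j I; exists n.
apply: bigcapT_measurable => m; apply: bigcapT_measurable => j.
apply: bigcupT_measurable => n.
have mf : measurable_fun setT (fun u : SeqOmega R => die_upto u 0 m n).
  apply: (measurable_extinct (fun u : SeqOmega R => u)) => i k.
  exact: measurable_seq_coord.
have := mf measurableT `]t - j.+1%:R^-1, +oo[%classic (measurable_itv _).
rewrite setTI (_ : _ @^-1` _ = [set u : SeqOmega R | t - j.+1%:R^-1 < die_upto u 0 m n])//.
by apply/seteqP; split => u /=; rewrite in_itv /= andbT.
Qed.

(** A supremum need not be attained, whence the slack [j.+1%:R^-1] in [die_inf_ge]. *)
Lemma die_inf_geP {R : realType} (t : R) (u : seqenv R) : right_env u ->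
  die_inf_ge t u <-> t <= die_inf u.
Proof.
move=> hu; split => [h|tu m j].
  apply: le_inf_range => m.
  apply: (le_of_vanishing _ 1 _ _ 0 (@cvg_harmonic R)) => j _.
  have [n hn] := h m j; have := extinct_le_die u 0 m n n hu.
  by move: hn; rewrite /die_upto /harmonic /=; move: (j.+1%:R^-1) (extinct _ _ _ _ _) => e v; lra.
apply: contrapT => /forallNP hn.
have : die u 0 m <= t - j.+1%:R^-1.
  by apply: sup_range_le => n; rewrite leNgt; apply/negP; exact: hn.
move=> /(le_trans (die_inf_le u m hu))/(le_trans tu).
by rewrite lerDl oppr_ge0 leNgt invr_gt0 ltr0n.
Qed.

(** * Stationarity makes [die_inf] constant along the shifts *)

Lemma negligible_setD_of_eq {d} {T : measurableType d} {R : realType}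
    (P : probability T R) (A B : set T) : measurable A -> measurable B ->
  P A = P B -> P.-negligible (A `\` B) -> P.-negligible (B `\` A).
Proof.
move=> mA mB PAB /(negligibleP _ (measurableD mA mB)) PD.
apply/(negligibleP _ (measurableD mB mA)).
(* Both differences have the measure of [A] minus that of the intersection, all of it finite. *)
have EA : P A = P (A `&` B) by rewrite (measureDI P mA mB) PD add0e.
have EB : P A = (P (B `\` A) + P (A `&` B))%E.
  by rewrite PAB [in RHS]setIC; exact: measureDI.
have fD : P (B `\` A) \is a fin_num by exact: fin_num_measure (measurableD mB mA).
have fI : P (A `&` B) \is a fin_num by exact: fin_num_measure (measurableI _ _ mA mB).
have : P (B `\` A) = 0%E.
  rewrite EA in EB; move: EB fD fI.
  move: (P (A `&` B)) (P (B `\` A)) => [x||] [y||] //.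
  by rewrite -EFinD => -[] h _ _; have -> : y = 0 by lra.
by [].
Qed.

Lemma right_env_proj {R : realType} (w : env R) :
  in_Omega_plus w -> right_env (proj_nonneg w).
Proof. by move=> hw i k; exact: hw. Qed.

Lemma right_env_iter {R : realType} (u : seqenv R) z :
  right_env u -> right_env (iter z seq_shift u).
Proof. by move=> hu; elim: z => [|z IH] //; exact: right_env_shift. Qed.

(** By [die_inf_shift] the level event at [z] lies almost surely in the one at [z.+1]; stationarity
    gives them equal probability, so they differ by a null set. *)
Lemma ae_die_inf_ge_shift {R : realType} (P : probability (Omega R) R) t z :
  {ae P, forall w : Omega R, in_Omega_plus w} -> stationary P ->
  {ae P, forall w : Omega R, t <= die_inf (iter z.+1 seq_shift (proj_nonneg w)) ->
     t <= die_inf (iter z seq_shift (proj_nonneg w))}.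
Proof.
move=> hO hs.
pose A y := proj_nonneg @^-1` (iter y seq_shift @^-1` die_inf_ge t).
have mA y : measurable (A y).
  by apply: measurable_proj_preimage; apply: measurable_iter_shift;
     exact: measurable_die_inf_ge.
have AP y (w : Omega R) : in_Omega_plus w ->
    A y w <-> t <= die_inf (iter y seq_shift (proj_nonneg w)).
  by move=> hw; apply: die_inf_geP; apply: right_env_iter; exact: right_env_proj.
have nA : P.-negligible (A z `\` A z.+1).
  apply: negligibleS hO => w [w1 w2] hw; apply: w2.
  apply/AP => //; apply: le_trans (_ : die_inf (iter z seq_shift (proj_nonneg w)) <= _).
    exact/AP.
  by apply: die_inf_shift; apply: right_env_iter; exact: right_env_proj.
have nB : P.-negligible (A z.+1 `\` A z).
  apply: negligible_setD_of_eq => //.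
  by rewrite /A !stationary_iter//; exact: measurable_die_inf_ge.
apply: negligibleS (negligibleU hO nB) => w /= h.
have [hw|] := pselect (in_Omega_plus w); last by left.
right; apply: contrapT => h'; apply: h => h1; apply/AP => //.
by apply: contrapT => h2; apply: h'; split => //; apply/AP.
Qed.

Lemma ae_constant_die_inf {R : realType} (P : probability (Omega R) R) :
  {ae P, forall w : Omega R, in_Omega_plus w} -> stationary P ->
  {ae P, forall w : Omega R,
     constant_die_inf (die_inf (proj_nonneg w)) (proj_nonneg w)}.
Proof.
move=> hO hs.
(* An enumeration of the rationals, with default 0, keeps the exceptional sets countable in
   number. *)
pose t n : R := if unpickle n is Some q then ratr (q : rat) else 0.
have h : {ae P, forall w : Omega R, forall n z,
    t n <= die_inf (iter z.+1 seq_shift (proj_nonneg w)) ->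
    t n <= die_inf (iter z seq_shift (proj_nonneg w))}.
  by apply: ae_foralln => n; apply: ae_foralln => z; exact: ae_die_inf_ge_shift.
apply: (@filterS2 _ _ (ae_filter_ringOfSetsType P)) hO h => w hw h; elim=> [|z IH] //.
rewrite -IH; apply/le_anti/andP; split; last first.
  by apply: die_inf_shift; apply: right_env_iter; exact: right_env_proj.
(* A strict increase would be witnessed by a rational level in between. *)
rewrite leNgt; apply/negP => /rat_in_itvoo[q]; rewrite in_itv /= => /andP[q1 q2].
have := h (pickle q) z; rewrite /t pickleK => /(_ (ltW q2)).
by rewrite leNgt q1.
Qed.

(** * The invariant event and the dichotomy *)

Definition die_inf_pos_io {R : realType} : set (SeqOmega R) :=
  [set u | forall n, exists z j, die_inf_ge j.+1%:R^-1 (iter (n + z) seq_shift u)].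

(** [ergodic] asks for an exactly invariant set, while positivity of [die_inf] is only shown to be
    invariant almost surely; requiring it at infinitely many shifts makes the invariance exact. *)
Lemma die_inf_pos_io_shift {R : realType} :
  seq_shift @^-1` die_inf_pos_io = @die_inf_pos_io R.
Proof.
apply/seteqP; split => u h n.
  by have [z [j hz]] := h n; exists z.+1, j; rewrite addnS iterSr.
by have [z [j hz]] := h n.+1; exists z, j; rewrite -iterSr -addSn.
Qed.

Lemma measurable_die_inf_pos_io {R : realType} : measurable (@die_inf_pos_io R).
Proof.
rewrite (_ : die_inf_pos_io = \bigcap_n \bigcup_z \bigcup_j
   (iter (n + z) seq_shift @^-1` die_inf_ge j.+1%:R^-1)); last first.
  apply/seteqP; split => u h.
    by move=> n _; have [z [j hz]] := h n; exists z => //; exists j.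
  by move=> n; have [z _ [j _ hz]] := h n I; exists z, j.
apply: bigcapT_measurable => n; apply: bigcupT_measurable => z.
apply: bigcupT_measurable => j; apply: measurable_iter_shift.
exact: measurable_die_inf_ge.
Qed.

Lemma die_inf_pos_ioP {R : realType} (u : seqenv R) p : right_env u ->
  constant_die_inf p u -> die_inf_pos_io u <-> 0 < p.
Proof.
move=> hu hc; split => [/(_ 0%N)[z [j]]|p0 n].
  move=> /(die_inf_geP _ _ (right_env_iter u _ hu)); rewrite hc.
  by apply: lt_le_trans; rewrite invr_gt0 ltr0n.
have [j hj] : exists j : nat, j.+1%:R^-1 <= p.
  exists (Num.bound p^-1); rewrite invf_ple ?posrE ?ltr0n//.
  by rewrite (le_trans (ltW (archi_boundP _)))// ?invr_ge0 ?ltW// ltr_nat.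
exists 0%N, j; apply/(die_inf_geP _ _ (right_env_iter u _ hu)).
by rewrite hc.
Qed.

(** There are [x.+1] shifts because the levels above [x] start at the site [x + 1]. *)
Lemma env_above_proj {R : realType} (w : env R) (x : nat) :
  env_above w x%:Z = iter x.+1 seq_shift (proj_nonneg w).
Proof.
have iterE z (u : seqenv R) i k : iter z seq_shift u i k = u (z + i)%N k.
  by elim: z i => [|z IH] i //=; rewrite /seq_shift IH addnS.
apply/funext => i; apply/funext => k.
by rewrite (iterE x.+1 (proj_nonneg w)) /env_above /proj_nonneg; congr w; lia.
Qed.

Theorem mainTheorem9 (R : realType) (P : probability (Omega R) R)
  (HOmega : {ae P, forall w : Omega R, in_Omega_plus w})
  (Hstat : stationary P) (Herg : ergodic P) :
  (forall x : nat, {ae P, forall w : Omega R, recurrent_site w x%:Z}) \/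
  (forall x : nat, {ae P, forall w : Omega R, transient_site w x%:Z}).
Proof.
have hc := ae_constant_die_inf P HOmega Hstat.
have mI := measurable_proj_preimage _ (@measurable_die_inf_pos_io R).
case: (Herg _ measurable_die_inf_pos_io die_inf_pos_io_shift) => PI.
- right=> x.
  have nI : {ae P, forall w : Omega R, ~ die_inf_pos_io (proj_nonneg w)}.
    rewrite /prop_near1 /= /nbhs /= /almost_everywhere.
    apply: negligibleS (proj2 (negligibleP P mI) PI) => w /= h.
    exact: contrapT.
  near=> w.
  have hw : in_Omega_plus w by near: w.
  have hcw : constant_die_inf (die_inf (proj_nonneg w)) (proj_nonneg w) by near: w.
  have hn : ~ die_inf_pos_io (proj_nonneg w) by near: w.
  move=> z; apply: hit_io0 => //; rewrite env_above_proj hcw.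
  have hu := right_env_proj w hw.
  have /andP[d0 _] := die_inf_bounds _ hu.
  apply/eqP; rewrite eq_le d0 andbT leNgt; apply/negP => d1; apply: hn.
  exact/(die_inf_pos_ioP _ _ hu hcw).
- left=> x.
  have nI : {ae P, forall w : Omega R, die_inf_pos_io (proj_nonneg w)}.
    rewrite /prop_near1 /= /nbhs /= /almost_everywhere.
    apply: (proj2 (negligibleP P (measurableC mI))).
    by apply: etrans (probability_setC P mI) _; rewrite PI subee.
  near=> w.
  have hw : in_Omega_plus w by near: w.
  have hcw : constant_die_inf (die_inf (proj_nonneg w)) (proj_nonneg w) by near: w.
  have hi : die_inf_pos_io (proj_nonneg w) by near: w.
  have hu := right_env_proj w hw.
  have d0 : 0 < die_inf (proj_nonneg w) by apply/(die_inf_pos_ioP _ _ hu hcw).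
  move=> z; apply: hit_io1 => // l k; apply: die_walker1.
    exact: right_env_above.
  (* Every further shift has the same constant positive [die_inf], so [die1] applies at each
     level. *)
  move=> z' k'; rewrite env_above_proj -iterD.
  apply: (@die1 _ _ (die_inf (proj_nonneg w))) => //; first exact: right_env_iter.
  by move=> z''; rewrite -iterD.
Unshelve. all: by end_near. Qed.
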